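(* For any graph $G$ we have that $\mathrm{gd}(G)\ge\nu^{=}(G)$. Moreover, equality $\mathrm{gd}(G)=\nu^{=}(G)$ holds if and only if there exists some $a\in\mathcal{D}(G)$ for which $\mathrm{gd}(G)=\mathrm{gd}(G,a)$.
   Context: Let $G=(V=[n],E)$ be a graph. $\mathcal{S}^n$ is the space of real symmetric $n\times n$ matrices with trace inner product $\langle X,Y\rangle=\mathrm{Tr}(XY)$, $\mathcal{S}^n_+$ the cone of positive semidefinite (psd) matrices, and $X\succeq 0$ means $X$ is psd. $E_{ij}=(e_ie_j^{T}+e_je_i^{T})/2$ with $e_1,\dots,e_n$ the standard unit vectors. $V$ is identified with the set of diagonal pairs $\{i,i\}$; $\overline{E}$ is the set of pairs $\{i,j\}$ with $i\neq j$, $\{i,j\}\notin E$. $\mathcal{C}(G)=\{X\in\mathcal{S}^n:\langle E_{ij},X\rangle=0\ \forall\{i,j\}\in\overline{E}\}$. $\mathrm{lin}$ denotes linear span. The corank of a matrix is the dimension of its kernel. $\mathcal{S}_+(G)$ is the set of $G$-partial psd matrices, i.e. vectors $a\in\mathbb{R}^{V\cup E}$ for which there is $X\in\mathcal{S}^n_+$ with $X_{ij}=a_{ij}$ for all $\{i,j\}\in V\cup E$. For $a\in\mathcal{S}_+(G)$, the Gram dimension $\mathrm{gd}(G,a)$ is the smallest integer $k\ge1$ for which there exist $p_1,\dots,p_n\in\mathbb{R}^k$ with $p_i^{T}p_j=a_{ij}$ for all $\{i,j\}\in V\cup E$. The Gram dimension of $G$ is $\mathrm{gd}(G)=\max_{a\in\mathcal{S}_+(G)}\mathrm{gd}(G,a)$.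 For $M\in\mathcal{S}^n$ of rank $r$ with spectral decomposition $M=Q\Lambda Q^{T}$ ($Q$ orthogonal, $\Lambda$ diagonal with $\Lambda_{ii}\neq0$ exactly for $i\in[r]$), set $$\mathcal{T}_M=\left\{Q\begin{pmatrix}U&W\\ W^{T}&0\end{pmatrix}Q^{T}:U\in\mathcal{S}^r,\ W\in\mathbb{R}^{r\times(n-r)}\right\}.$$ $M\in\mathcal{C}(G)$ satisfies the Strong Arnold Property (SAP) if $\mathcal{T}_M+\mathrm{lin}\{E_{ij}:\{i,j\}\in V\cup E\}=\mathcal{S}^n$. The parameter $\nu^{=}(G)$ is the maximum corank of a matrix $M\in\mathcal{C}(G)\cap\mathcal{S}^n_+$ satisfying the SAP. For $a\in\mathcal{S}_+(G)$ consider the semidefinite program $$(D_a)\quad \inf_{y,Z}\Big\{\sum_{\{i,j\}\in V\cup E}y_{ij}a_{ij}:\ \sum_{\{i,j\}\in V\cup E}y_{ij}E_{ij}=Z\succeq0\Big\},$$ which is the dual of $\sup_X\{0:\langle E_{ij},X\rangle=a_{ij}\ \text{for }\{i,j\}\in V\cup E,\ X\succeq0\}$. A feasible solution $(y,Z)$ of $(D_a)$ is (dual) nondegenerate if $\mathcal{T}_Z+\mathrm{lin}\{E_{ij}:\{i,j\}\in V\cup E\}=\mathcal{S}^n$. $\mathcal{D}(G)$ denotes the set of $a\in\mathcal{S}_+(G)$ for which $(D_a)$ has a nondegenerate optimal solution. *)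

(* Defs.v *)
From mathcomp Require Import all_boot all_order all_algebra ring lra.
From mathcomp Require Import boolp classical_sets reals.
Set Implicit Arguments.
Unset Strict Implicit.
Unset Printing Implicit Defensive.
Import Order.TTheory GRing.Theory Num.Theory.
Local Open Scope classical_set_scope.
Local Open Scope ring_scope.

(* Maximum and minimum of a set of naturals; 0 when there is none (see
   [gdimP], [gd_graphP] and [nu_eqP] for the sets they are used on). *)
Definition max_of (A : set nat) : nat := xget 0%N (A `&` ubound A).
Definition min_of (A : set nat) : nat := xget 0%N (A `&` lbound A).

Section Matrices.
Variables (R : realType) (n : nat).

Definition Sym : set 'M[R]_n := [set X | X^T = X].

Definition psd (X : 'M[R]_n) : Prop :=
  Sym X /\ forall v : 'cV[R]_n, 0 <= (v^T *m X *m v) 0 0.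

Definition Emx (i j : 'I_n) : 'M[R]_n :=
  2%:R^-1 *: (delta_mx i j + delta_mx j i).

Definition trinner (X Y : 'M[R]_n) : R := \tr (X *m Y).

Definition corank (M : 'M[R]_n) : nat := \rank (kermx M).

Definition spectral_decomp (M Q : 'M[R]_n) (d : 'rV[R]_n) : Prop :=
  [/\ Q^T *m Q = 1%:M, M = Q *m diag_mx d *m Q^T &
      forall i : 'I_n, (d 0 i != 0) = (i < \rank M)%N].

Definition tangent_block (r : nat) (le_rn : (r <= n)%N)
    (U : 'M[R]_r) (W : 'M[R]_(r, n - r)) : 'M[R]_n :=
  castmx (subnKC le_rn, subnKC le_rn) (block_mx U W W^T 0).

(* For symmetric [M] the set of all [Q B Q^T] with [B] of this block form does
   not depend on the spectral decomposition, so [Q] may be quantified here. *)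
Definition tangent (M : 'M[R]_n) : set 'M[R]_n :=
  [set X | exists (Q : 'M[R]_n) (d : 'rV[R]_n)
             (U : 'M[R]_(\rank M)) (W : 'M[R]_(\rank M, n - \rank M)),
     [/\ spectral_decomp M Q d, U^T = U &
         X = Q *m tangent_block (rank_leq_row M) U W *m Q^T]].

End Matrices.

(* The index set V u E: the unordered pair {i, j}, with i = j for vertices, is
   represented by its ordered version (i, j) with i <= j. *)
Definition VE (n : nat) (e : rel 'I_n) : Type :=
  {p : 'I_n * 'I_n | (p.1 <= p.2)%N && ((p.1 == p.2) || e p.1 p.2)}.

Section GraphParameters.
Variables (R : realType) (n : nat) (e : rel 'I_n).

Definition VE1 (q : VE e) : 'I_n := (sval q).1.
Definition VE2 (q : VE e) : 'I_n := (sval q).2.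

Definition CG : set 'M[R]_n :=
  [set X | Sym X /\
     forall i j : 'I_n, i != j -> ~~ e i j -> trinner (Emx R i j) X = 0].

Definition linE : {vspace 'M[R]_n} :=
  <<[seq Emx R (VE1 q) (VE2 q) | q : VE e]>>%VS.

Definition tangent_spans (M : 'M[R]_n) : Prop :=
  [set X + Y | X in tangent M & Y in [set Y | Y \in linE]] = @Sym R n.

Definition SAP (M : 'M[R]_n) : Prop := CG M /\ tangent_spans M.

Definition nu_eq : nat :=
  max_of [set corank M | M in [set M | [/\ CG M, psd M & SAP M]]].

Definition partial_psd : set {ffun VE e -> R} :=
  [set a | exists X : 'M[R]_n, psd X /\ forall q, X (VE1 q) (VE2 q) = a q].

Definition gram_rep (a : {ffun VE e -> R}) (k : nat) : Prop :=
  exists p : 'I_n -> 'cV[R]_k,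
    forall q, ((p (VE1 q))^T *m p (VE2 q)) 0 0 = a q.

Definition gdim (a : {ffun VE e -> R}) : nat :=
  min_of [set k | (1 <= k)%N /\ gram_rep a k].

Definition gd_graph : nat := max_of [set gdim a | a in partial_psd].

Definition dual_feasible (y : {ffun VE e -> R}) (Z : 'M[R]_n) : Prop :=
  \sum_q y q *: Emx R (VE1 q) (VE2 q) = Z /\ psd Z.

Definition dual_value (a y : {ffun VE e -> R}) : R := \sum_q y q * a q.

Definition dual_optimal (a y : {ffun VE e -> R}) (Z : 'M[R]_n) : Prop :=
  dual_feasible y Z /\
  forall y' Z', dual_feasible y' Z' -> dual_value a y <= dual_value a y'.

Definition dual_nondegenerate (y : {ffun VE e -> R}) (Z : 'M[R]_n) : Prop :=
  dual_feasible y Z /\ tangent_spans Z.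

Definition DG : set {ffun VE e -> R} :=
  [set a | partial_psd a /\
     exists y Z, dual_optimal a y Z /\ dual_nondegenerate y Z].

End GraphParameters.

Lemma max_ofP (A : set nat) (m : nat) :
  A !=set0 -> (forall k, A k -> (k <= m)%N) ->
  A (max_of A) /\ forall k, A k -> (k <= max_of A)%N.
Proof.
move=> [k0 Ak0] Am.
have exA : exists k, `[< A k >] by exists k0; apply/asboolP.
have ubA k : `[< A k >] -> (k <= m)%N by move=> /asboolP; exact: Am.
case: (ex_maxnP exA ubA) => j /asboolP Aj jmax.
have : (A `&` ubound A) (max_of A).
  apply: xgetPex; exists j; split=> // k Ak.
  by rewrite leEnat; apply/jmax/asboolP.
by case=> ? ub; split=> // k /ub; rewrite leEnat.
Qed.

Lemma min_ofP (A : set nat) :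
  A !=set0 -> A (min_of A) /\ forall k, A k -> (min_of A <= k)%N.
Proof.
move=> [k0 Ak0].
have exA : exists k, `[< A k >] by exists k0; apply/asboolP.
case: (ex_minnP exA) => j /asboolP Aj jmin.
have : (A `&` lbound A) (min_of A).
  apply: xgetPex; exists j; split=> // k Ak.
  by rewrite leEnat; apply/jmin/asboolP.
by case=> ? lb; split=> // k /lb; rewrite leEnat.
Qed.

Lemma psd_gram_step (R : realType) (n : nat) (a : R) (w : 'rV[R]_n) (Y : 'M[R]_n) :
  (forall Y : 'M[R]_n, psd Y -> exists B : 'M[R]_n, B^T *m B = Y) ->
  psd (block_mx a%:M w w^T Y : 'M_(1 + n)) ->
  exists B : 'M[R]_(1 + n), B^T *m B = block_mx a%:M w w^T Y.
Proof.
move=> IHn [Xsym Xpos].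
have YT : Y^T = Y.
  by move: Xsym; rewrite /Sym /= tr_block_mx => /eq_block_mx[].
have q_ge0 (t : R) (u : 'cV[R]_n) :
    0 <= t * (a * t) + t * (w *m u) 0 0 *+ 2 + (u^T *m Y *m u) 0 0.
  have := Xpos (col_mx t%:M u).
  rewrite tr_col_mx tr_scalar_mx mul_row_block mul_row_col.
  rewrite !mulmxDl.
  have wE : (u^T *m w^T) 0 0 = (w *m u) 0 0 by rewrite -trmx_mul mxE.
  rewrite !mul_mx_scalar !mul_scalar_mx -!scalemxAl.
  rewrite [X in 0 <= X -> _](_ : _ = t * (a * t) + t * (u^T *m w^T) 0 0 +
    (t * (w *m u) 0 0 + (u^T *m Y *m u) 0 0)); last first.
    by rewrite !mxE eqxx mulr1n.
  by rewrite wE mulr2n !addrA.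
have a_ge0 : 0 <= a.
  by have := q_ge0 1 0; rewrite !mulmx0 !mxE mulr0 mul0rn !addr0 mul1r mulr1.
have [a0|a_neq0] := eqVneq a 0.
  have w0 : w = 0.
    apply/rowP=> j; rewrite [RHS]mxE; apply/eqP/negP=> /negP wj.
    pose c := (delta_mx j 0 : 'cV[R]_n).
    have wc : (w *m c) 0 0 = w 0 j by rewrite -colE mxE.
    have := q_ge0 (- ((c^T *m Y *m c) 0 0 + 1) / (2 * w 0 j)) c.
    rewrite wc a0 mul0r mulr0 add0r; set y := (c^T *m Y *m c) 0 0.
    have -> : - (y + 1) / (2 * w 0 j) * w 0 j *+ 2 = - (y + 1) by field.
    by lra.
  have [|C CE] := IHn Y.
    split=> // v; have := q_ge0 0 v.
    by rewrite !mul0r mul0rn !add0r.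
  exists (block_mx 0 0 0 C).
  by rewrite tr_block_mx mulmx_block !trmx0 !mul0mx !mulmx0 !addr0 CE a0 w0 trmx0 raddf0 add0r.
have a_gt0 : 0 < a by rewrite lt_def a_neq0.
pose s := Num.sqrt a.
have s_neq0 : s != 0 by rewrite sqrtr_eq0 -ltNge.
have ss : s * s = a by rewrite -expr2 sqr_sqrtr.
have [|C CE] := IHn (Y - a^-1 *: (w^T *m w)).
  split=> [|v].
    by rewrite /Sym /= linearB linearZ /= trmx_mul trmxK YT.
  have := q_ge0 (- (a^-1 * (w *m v) 0 0)) v.
  have vw : (v^T *m w^T *m (w *m v)) 0 0 = (w *m v) 0 0 ^+ 2.
    by rewrite -trmx_mul mxE big_ord1 mxE.
  rewrite mulmxBr mulmxBl -scalemxAr -scalemxAl !mulmxA.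
  rewrite -[v^T *m w^T *m w *m v]mulmxA.
  rewrite [X in _ -> 0 <= X](_ : _ = (v^T *m Y *m v) 0 0 -
     a^-1 * (v^T *m w^T *m (w *m v)) 0 0); last by rewrite !mxE.
  rewrite vw; set x := (w *m v) 0 0; set y := (_ *m v) 0 0.
  suff -> : - (a^-1 * x) * (a * - (a^-1 * x)) + - (a^-1 * x) * x *+ 2 + y = y - a^-1 * x ^+ 2 by [].
  by field.
exists (block_mx s%:M (s^-1 *: w) 0 C).
rewrite tr_block_mx mulmx_block !tr_scalar_mx trmx0 !mul0mx !mulmx0 !addr0 CE.
rewrite -scalar_mxM ss mul_scalar_mx scalerA mulfV // scale1r linearZ /=.
rewrite mul_mx_scalar scalerA mulfV // scale1r -scalemxAl -scalemxAr scalerA.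
by rewrite -invfM ss addrC subrK.
Qed.

Lemma psd_gram (R : realType) (n : nat) (X : 'M[R]_n) :
  psd X -> exists B : 'M[R]_n, B^T *m B = X.
Proof.
elim: n X => [|n IHn] X Xpsd.
  by exists 0; apply/matrixP; case.
pose X' : 'M[R]_(1 + n) := X.
have XE : block_mx (X 0 0)%:M (ursubmx X') (ursubmx X')^T (drsubmx X') = X'.
  rewrite -[RHS]submxK trmx_ursub.
  have -> : X'^T = X' by case: Xpsd.
  congr block_mx; apply/matrixP=> i j; rewrite !ord1 !mxE eqxx mulr1n.
  by congr (X _ _); apply/val_inj.
have := @psd_gram_step R n (X 0 0) (ursubmx X') (drsubmx X') IHn.
by rewrite XE; apply.
Qed.

Section WellDefined.
Variables (R : realType) (n : nat) (e : rel 'I_n).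

Lemma gdimP (n_gt0 : (0 < n)%N) (a : {ffun VE e -> R}) : partial_psd a ->
  [/\ (1 <= gdim a)%N, gram_rep a (gdim a) &
      forall k, (1 <= k)%N -> gram_rep a k -> (gdim a <= k)%N] /\ (gdim a <= n)%N.
Proof.
move=> [X [/psd_gram [B BE] Xa]].
have an : gram_rep a n.
  exists (fun i => col i B) => q; rewrite -Xa -BE !mxE.
  by apply: eq_bigr => j _; rewrite !mxE.
have [|[? ?] gmin] := @min_ofP [set k | (1 <= k)%N /\ gram_rep a k].
  by exists n.
by split; [split=> // k k1 ak; apply: gmin|apply: gmin].
Qed.

Lemma gd_graphP (n_gt0 : (0 < n)%N) :
  (exists a : {ffun VE e -> R}, partial_psd a /\ gdim a = gd_graph R e) /\
  (forall a : {ffun VE e -> R}, partial_psd a -> (gdim a <= gd_graph R e)%N).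
Proof.
have [||[a Sa aE] gmax] := @max_ofP [set gdim a | a in @partial_psd R n e] n.
- pose z : {ffun VE e -> R} := [ffun=> 0]; exists (gdim z), z => //.
  exists 0; split=> [|q]; last by rewrite /z ffunE mxE.
  by split=> [|v]; rewrite /Sym /= ?trmx0 // mulmx0 mul0mx mxE.
- by move=> _ [a Sa <-]; case: (gdimP n_gt0 Sa).
by split; [exists a|move=> b Sb; apply: gmax; exists b].
Qed.

Lemma nu_eqP :
  (exists M, [/\ @CG R n e M, psd M, SAP e M & corank M = nu_eq R e]) /\
  (forall M, @CG R n e M -> psd M -> SAP e M -> (corank M <= nu_eq R e)%N).
Proof.
have [||[M [? ? ?] ME] numax] :=
    @max_ofP [set corank M | M in [set M | [/\ @CG R n e M, psd M & SAP e M]]] n.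
- exists (corank (1%:M : 'M[R]_n)), 1%:M => //.
  have C1 : @CG R n e 1%:M.
    split=> [|i j ij _]; first exact: trmx1.
    rewrite /trinner mulmx1 linearZ /= raddfD /= !/mxtrace.
    rewrite !big1 ?addr0 ?mulr0 // => k _; rewrite mxE.
      by case: eqVneq => [->|]//=; rewrite eq_sym (negPf ij).
    by case: eqVneq => [->|]//=; rewrite (negPf ij).
  split=> //.
    split=> [|v]; first exact: trmx1.
    rewrite mulmx1 mxE; apply: sumr_ge0 => i _.
    by rewrite mxE -expr2 sqr_ge0.
  split=> //; apply/seteqP; split=> [S [X [Q [d [U [W [_ UT ->]]]]] [Y Ylin <-]]|S ST].
    rewrite /Sym /= linearD /=; congr (_ + _).
      rewrite !trmx_mul trmxK mulmxA /tangent_block trmx_cast tr_block_mx.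
      by rewrite UT trmxK trmx0.
    rewrite (@coord_span _ _ _ (in_tuple _) _ Ylin) linear_sum /=.
    apply: eq_bigr => k _; rewrite linearZ /=; congr (_ *: _).
    have /mapP[q _ ->] := mem_nth 0 (ltn_ord k).
    by rewrite /Emx linearZ linearD /= !trmx_delta addrC.
  exists S; last by exists 0; rewrite ?addr0 //=; apply: mem0v.
  exists 1%:M, (const_mx 1).
  pose S' : 'M_(\rank (1%:M : 'M[R]_n) + (n - \rank (1%:M : 'M[R]_n))) :=
    castmx (esym (subnKC (rank_leq_row _)), esym (subnKC (rank_leq_row _))) S.
  have ST' : S'^T = S' by rewrite /S' trmx_cast ST.
  exists (ulsubmx S'), (ursubmx S'); split.
  + split; first by rewrite trmx1 mul1mx.
      by rewrite mul1mx trmx1 mulmx1; apply/matrixP=> i j; rewrite !mxE.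
    by move=> i; rewrite mxE oner_neq0 mxrank1 ltn_ord.
  + by rewrite trmx_ulsub ST'.
  rewrite mul1mx trmx1 mulmx1 /tangent_block trmx_ursub ST'.
  suff -> : 0 = drsubmx S' by rewrite submxK /S' castmx_comp castmx_id.
  by apply/matrixP=> -[i ilt]; exfalso; move: ilt; rewrite mxrank1 subnn.
- by move=> _ [M _ <-]; apply: rank_leq_row.
by split; [exists M|move=> N ? ? ?; apply: numax; exists N].
Qed.

End WellDefined.

(* Main.v *)
(* A dual feasible psd matrix Z and a psd completion X of a satisfy
   <y, a> = <Z, X> >= 0, and y = 0 is feasible, so (y, Z) is optimal exactly
   when Z X = 0.  The orthogonal complement of T_Z + lin{E_ij} consists of the
   symmetric S with Z S = 0 vanishing on V u E.  Hence a nondegenerate optimal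
   Z makes the completion X unique, and rank X <= corank Z; conversely, for M
   with the SAP take X psd with range ker M: then M is optimal and
   nondegenerate for the projection a of X, and gd(G, a) is the rank of X,
   that is the corank of M.  Only corank 0 needs care, since gd(G, a) >= 1;
   diag(1, ..., 1, 0) shows that the parameter nu^= is positive. *)
Require Import Defs.
From mathcomp Require Import all_boot all_order all_algebra.
From mathcomp Require Import boolp classical_sets reals.
Set Implicit Arguments.
Unset Strict Implicit.
Unset Printing Implicit Defensive.
Import Order.TTheory GRing.Theory Num.Theory.
Local Open Scope classical_set_scope.
Local Open Scope ring_scope.

(** * Trace inner products of psd matrices *)

Section PsdMatrices.
Variable R : realType.

Lemma mxtrace_mul_tr m n (A : 'M[R]_(m, n)) :
  \tr (A *m A^T) = \sum_i \sum_j A i j ^+ 2.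
Proof.
apply: eq_bigr => i _; rewrite mxE; apply: eq_bigr => j _.
by rewrite mxE expr2.
Qed.

Lemma mxtrace_mul_tr_ge0 m n (A : 'M[R]_(m, n)) : 0 <= \tr (A *m A^T).
Proof.
rewrite mxtrace_mul_tr; apply: sumr_ge0 => i _; apply: sumr_ge0 => j _.
exact: sqr_ge0.
Qed.

Lemma mxtrace_mul_tr_eq0 m n (A : 'M[R]_(m, n)) : \tr (A *m A^T) = 0 -> A = 0.
Proof.
rewrite mxtrace_mul_tr => /eqP; rewrite psumr_eq0; last first.
  by move=> i _; apply: sumr_ge0 => j _; apply: sqr_ge0.
move=> /allP sA; apply/matrixP => i j; rewrite mxE; apply/eqP.
have /= := sA i (mem_index_enum i).
rewrite psumr_eq0 => [/allP/(_ j (mem_index_enum j))/=|k _].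
  by rewrite sqrf_eq0.
exact: sqr_ge0.
Qed.

Lemma psd_mul_tr k n (P : 'M[R]_(k, n)) : psd (P^T *m P).
Proof.
split=> [|v]; first by rewrite /Sym /= trmx_mul trmxK.
rewrite mulmxA -mulmxA -trmx_mul mxE; apply: sumr_ge0 => i _.
by rewrite mxE -expr2 sqr_ge0.
Qed.

Lemma trinner_gram k n (C : 'M[R]_n) (P : 'M[R]_(k, n)) :
  trinner (C^T *m C) (P^T *m P) = \tr ((C *m P^T) *m (C *m P^T)^T).
Proof.
by rewrite /trinner trmx_mul trmxK -mulmxA mxtrace_mulC !mulmxA.
Qed.

Lemma trinner_psd_ge0 n (Z X : 'M[R]_n) : psd Z -> psd X -> 0 <= trinner Z X.
Proof.
move=> /psd_gram[C <-] /psd_gram[B <-]; rewrite trinner_gram.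
exact: mxtrace_mul_tr_ge0.
Qed.

(** With Z = C^T C the inner product is the squared Frobenius norm of [C *m P^T], so that factor
    already vanishes. This is complementary slackness. *)
Lemma trinner_psd_eq0 k n (Z : 'M[R]_n) (P : 'M[R]_(k, n)) :
  psd Z -> trinner Z (P^T *m P) = 0 -> Z *m P^T = 0.
Proof.
move=> /psd_gram[C <-]; rewrite trinner_gram => /mxtrace_mul_tr_eq0 CP0.
by rewrite -mulmxA CP0 mulmx0.
Qed.

End PsdMatrices.

(** * The matrices E_ij and their span *)

Section Graph.
Variables (R : realType) (n : nat) (e : rel 'I_n).

Lemma tr_Emx (i j : 'I_n) : (Emx R i j)^T = Emx R i j.
Proof. by rewrite /Emx linearZ linearD /= !trmx_delta addrC. Qed.

Lemma trinner_Emx (i j : 'I_n) (X : 'M[R]_n) :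
  Sym X -> trinner (Emx R i j) X = X i j.
Proof.
have tr_delta k l : \tr (delta_mx k l *m X) = X l k.
  rewrite /mxtrace (bigD1 k) //= big1 ?addr0 => [|p pk].
    rewrite mxE (bigD1 l) //= big1 ?addr0 => [|p pl].
      by rewrite mxE !eqxx mul1r.
    by rewrite mxE (negPf pl) andbF mul0r.
  by rewrite mxE big1 // => q _; rewrite mxE (negPf pk) mul0r.
move=> XT; rewrite /trinner /Emx -scalemxAl mulmxDl mxtraceZ mxtraceD.
rewrite !tr_delta (_ : X j i = X i j); last first.
  by rewrite -[in LHS](XT : X^T = X) mxE.
rewrite -mulr2n -[X i j *+ 2]mulr_natl mulrA.
by rewrite mulVf ?mul1r ?pnatr_eq0.
Qed.

Lemma tr_linE (Y : 'M[R]_n) : Y \in linE R e -> Y^T = Y.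
Proof.
move=> Ylin; rewrite (@coord_span _ _ _ (in_tuple _) _ Ylin) linear_sum /=.
apply: eq_bigr => k _; rewrite linearZ /=; congr (_ *: _).
by have /mapP[q _ ->] := mem_nth 0 (ltn_ord k); exact: tr_Emx.
Qed.

Lemma trinner_linE (S Y : 'M[R]_n) : Sym S ->
  (forall q : VE e, S (VE1 q) (VE2 q) = 0) -> Y \in linE R e -> trinner Y S = 0.
Proof.
move=> ST S0 Ylin; rewrite (@coord_span _ _ _ (in_tuple _) _ Ylin).
rewrite /trinner mulmx_suml linear_sum /= big1 // => k _.
rewrite -scalemxAl mxtraceZ.
have /mapP[q _ ->] := mem_nth 0 (ltn_ord k).
by rewrite [\tr _](trinner_Emx _ _ ST) S0 mulr0.
Qed.

(** * The tangent space and its orthogonal complement *)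

Lemma tangent_block_dr r (le_rn : (r <= n)%N) (U : 'M[R]_r)
    (W : 'M[R]_(r, n - r)) (i j : 'I_n) :
  (r <= i)%N -> (r <= j)%N -> tangent_block le_rn U W i j = 0.
Proof.
move=> ri rj; rewrite /tangent_block castmxE /=.
have dr (k : 'I_n) : (r <= k)%N ->
    exists k', cast_ord (esym (subnKC le_rn)) k = rshift r k'.
  move=> rk; case: (split_ordP (cast_ord (esym (subnKC le_rn)) k)) => k' kE.
    by move: (congr1 val kE) (ltn_ord k') => /= <-; rewrite ltnNge rk.
  by exists k'.
by have [[i' ->] [j' ->]] := (dr i ri, dr j rj); rewrite block_mxEdr mxE.
Qed.

Lemma tr_tangent (M X : 'M[R]_n) : tangent M X -> X^T = X.
Proof.
move=> [Q [d [U [W [_ UT ->]]]]].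
rewrite !trmx_mul trmxK mulmxA /tangent_block trmx_cast tr_block_mx.
by rewrite UT trmxK trmx0.
Qed.

(** In an eigenbasis of M, the equation M S = 0 kills the rows of S at nonzero eigenvalues, and
    symmetry kills those columns. Only the lower right block of S survives, which is where tangent
    matrices are zero. *)
Lemma trinner_tangent (M S X : 'M[R]_n) :
  Sym S -> M *m S = 0 -> tangent M X -> trinner X S = 0.
Proof.
move=> ST MS [Q [d [U [W [[QQ ME dr] _ ->]]]]].
pose S' := Q^T *m S *m Q.
have S'T : S'^T = S' by rewrite /S' !trmx_mul trmxK ST mulmxA.
have dS' : diag_mx d *m S' = 0.
  have -> : diag_mx d *m S' = Q^T *m M *m S *m Q.
    by rewrite {1}ME /S' !mulmxA QQ mul1mx.
  by rewrite -[Q^T *m M *m S]mulmxA MS mulmx0 mul0mx.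
have S'0 (i j : 'I_n) : (i < \rank M)%N -> S' i j = 0.
  rewrite -dr => di; move/matrixP: dS' => /(_ i j).
  by rewrite mul_diag_mx !mxE => /eqP; rewrite mulf_eq0 (negPf di) => /eqP.
rewrite /trinner -!mulmxA mxtrace_mulC -!mulmxA [Q^T *m (S *m Q)]mulmxA.
rewrite -/S' /mxtrace big1 // => i _; rewrite mxE big1 // => j _.
have [jr|jr] := ltnP j (\rank M); first by rewrite S'0 ?mulr0.
have [ir|ir] := ltnP i (\rank M); first by rewrite -S'T mxE S'0 ?mulr0.
by rewrite tangent_block_dr ?mul0r.
Qed.

(** S is orthogonal to both summands of the space of symmetric matrices, hence to itself. *)
Lemma tangent_spans_eq0 (M S : 'M[R]_n) : tangent_spans e M -> Sym S ->
  M *m S = 0 -> (forall q : VE e, S (VE1 q) (VE2 q) = 0) -> S = 0.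
Proof.
move=> spM ST MS S0; have : Sym S by [].
rewrite -spM => -[A TA [Y Ylin SE]]; apply: mxtrace_mul_tr_eq0.
rewrite ST -{1}SE mulmxDl linearD /=.
rewrite [\tr _](trinner_tangent ST MS TA) [\tr _](trinner_linE ST S0 Ylin).
exact: addr0.
Qed.

(** * Combinations of the E_ij as the matrices of C(G) *)

Lemma Emx_VE (q : VE e) (i j : 'I_n) : (i <= j)%N ->
  Emx R (VE1 q) (VE2 q) i j =
    if sval q == (i, j) then (if i == j then 1 else 2%:R^-1) else 0.
Proof.
case: q => -[k l] /= kl ij; rewrite /VE1 /VE2 /= !mxE.
have {}kl : (k <= l)%N by case/andP: kl.
rewrite xpair_eqE (eq_sym i k) (eq_sym j l).
have [<-|ki] := eqVneq k i; have [<-|lj] := eqVneq l j => /=.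
- rewrite (eq_sym l k); case: eqVneq => _; rewrite ?addr0 ?mulr1 //.
  by rewrite -mulr2n mulVf ?pnatr_eq0.
- rewrite (eq_sym j k) (eq_sym k l).
  case: eqVneq => [lk|]; case: eqVneq => [jk|]; rewrite /= ?addr0 ?mulr0 //.
  by move: lj; rewrite lk -jk eqxx.
- rewrite (eq_sym i l) (eq_sym l k).
  case: eqVneq => [li|]; case: eqVneq => [kl'|]; rewrite /= ?addr0 ?mulr0 //.
  by move: ki; rewrite kl' -li eqxx.
(* A transposed match i = l, j = k would give k <= l = i <= j = k, against k != i. *)
have [il|] := eqVneq i l; have [jk|] := eqVneq j k; rewrite /= ?addr0 ?mulr0 //.
move: ki; suff -> : k = i by rewrite eqxx.
by apply/val_inj/eqP; rewrite eqn_leq {1}il -{2}jk kl ij.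
Qed.

Lemma tr_sum_Emx (y : {ffun VE e -> R}) :
  (\sum_q y q *: Emx R (VE1 q) (VE2 q))^T = \sum_q y q *: Emx R (VE1 q) (VE2 q).
Proof.
rewrite linear_sum; apply: eq_bigr => q _.
by rewrite linearZ /= tr_Emx.
Qed.

Lemma dual_feasible_CG (y : {ffun VE e -> R}) (Z : 'M[R]_n) :
  symmetric e -> dual_feasible y Z -> CG e Z.
Proof.
move=> e_sym [ZE [ZT _]]; split=> // i j ij eij; rewrite trinner_Emx //.
wlog leij : i j ij eij / (i <= j)%N.
  move=> H; have [/H->//|ji] := leqP i j.
  by rewrite -ZT mxE H ?(ltnW ji) // 1?eq_sym // e_sym.
rewrite -ZE summxE big1 // => q _; rewrite mxE Emx_VE //.
case: eqP => [qE|_]; last by rewrite mulr0.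
by have := svalP q; rewrite qE /= (negPf ij) (negPf eij) andbF.
Qed.

Lemma CG_sum_Emx (M : 'M[R]_n) : CG e M ->
  exists y : {ffun VE e -> R}, \sum_q y q *: Emx R (VE1 q) (VE2 q) = M.
Proof.
move=> [MT M0].
(* The multiplier is 1 on the diagonal and 2 off it, offsetting the off-diagonal entries 1/2 of
   E_ij. *)
pose y := [ffun q : VE e => M (VE1 q) (VE2 q) *+ (VE1 q != VE2 q).+1].
exists y; apply/matrixP => i j.
wlog leij : i j / (i <= j)%N.
  move=> H; have [/H//|/ltnW/H ji] := leqP i j.
  by rewrite -tr_sum_Emx -MT [LHS]mxE [RHS]mxE.
rewrite summxE.
have [ijE|nE] := boolP ((i <= j)%N && ((i == j) || e i j)).
  pose q0 : VE e := exist _ (i, j) ijE.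
  rewrite (bigD1 q0) //= big1 ?addr0 => [|q qq0]; last first.
    by rewrite mxE Emx_VE // ifN // mulr0.
  rewrite mxE Emx_VE //= eqxx ffunE /VE1 /VE2 /=.
  case: eqVneq => [->|_]; first by rewrite mulr1.
  by rewrite -(mulr_natl (M i j)) mulrAC mulfV ?mul1r ?pnatr_eq0.
move: nE; rewrite leij /= negb_or => /andP[ij eij].
rewrite -[RHS](trinner_Emx i j MT) M0 // big1 // => q _; rewrite mxE Emx_VE //.
case: eqP => [qE|_]; last by rewrite mulr0.
by have := svalP q; rewrite qE /= (negPf ij) (negPf eij) andbF.
Qed.

(** * Dual optima and the Gram dimension *)

Lemma dual_value_trinner (a y : {ffun VE e -> R}) (Z X : 'M[R]_n) :
  \sum_q y q *: Emx R (VE1 q) (VE2 q) = Z -> Sym X ->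
  (forall q, X (VE1 q) (VE2 q) = a q) -> dual_value a y = trinner Z X.
Proof.
move=> <- XT Xa; rewrite /trinner mulmx_suml linear_sum /=.
apply: eq_bigr => q _; rewrite -scalemxAl mxtraceZ -Xa.
by rewrite -(trinner_Emx _ _ XT).
Qed.

Lemma gram_repP (a : {ffun VE e -> R}) k :
  gram_rep a k <->
  exists P : 'M[R]_(k, n), forall q, (P^T *m P) (VE1 q) (VE2 q) = a q.
Proof.
split=> [[p pa]|[P Pa]].
  exists (\matrix_(i, j) p j i 0) => q; rewrite -pa !mxE.
  by apply: eq_bigr => i _; rewrite !mxE.
exists (fun i => col i P) => q; rewrite -Pa !mxE.
by apply: eq_bigr => i _; rewrite !mxE.
Qed.

Lemma gram_repW (a : {ffun VE e -> R}) k l :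
  (k <= l)%N -> gram_rep a k -> gram_rep a l.
Proof.
(* The vectors are padded with zero coordinates. *)
move=> kl /gram_repP[P Pa]; apply/gram_repP; exists (pid_mx k *m P) => q.
rewrite trmx_mul -mulmxA [X in _ *m X]mulmxA tr_pid_mx mul_pid_mx.
by rewrite minnn (minn_idPr kl) pid_mx_1 mul1mx.
Qed.

Lemma dual_optimal0 (a y : {ffun VE e -> R}) (Z : 'M[R]_n) :
  partial_psd a -> dual_optimal a y Z -> dual_value a y = 0.
Proof.
move=> [X [Xpsd Xa]] [[ZE Zpsd] yopt]; apply/eqP; rewrite eq_le.
rewrite {2}(dual_value_trinner ZE Xpsd.1 Xa) trinner_psd_ge0 // andbT.
have feas0 : dual_feasible [ffun _ : VE e => 0 : R] (0 : 'M[R]_n).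
  split; first by rewrite big1 // => q _; rewrite ffunE scale0r.
  by have := psd_mul_tr (0 : 'M[R]_n); rewrite mulmx0.
apply: le_trans (yopt _ _ feas0) _.
by rewrite /dual_value big1 // => q _; rewrite ffunE mul0r.
Qed.

(** By complementary slackness the rows of a Gram factor of any psd completion lie in ker Z, so its
    rank is at most corank Z. The maximum with 1 reflects the convention k >= 1 in the Gram
    dimension. *)
Lemma gdim_dual_optimal (a y : {ffun VE e -> R}) (Z : 'M[R]_n) : (0 < n)%N ->
  partial_psd a -> dual_optimal a y Z -> (gdim a <= maxn 1 (corank Z))%N.
Proof.
move=> n_gt0 Sa yopt; have y0 := dual_optimal0 Sa yopt.
have [[_ _ gmin] _] := gdimP n_gt0 Sa.
apply: gmin (leq_maxl _ _) _; apply: gram_repW (leq_maxr _ _) _.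
case: (Sa) => X [Xpsd Xa]; have [B BE] := psd_gram Xpsd.
have [[ZE Zpsd] _] := yopt.
have BZ : (B <= row_base (kermx Z))%MS.
  rewrite eq_row_base; apply/sub_kermxP/trmx_inj.
  rewrite trmx_mul trmx0 Zpsd.1; apply: trinner_psd_eq0 => //.
  by rewrite BE -(dual_value_trinner ZE Xpsd.1 Xa).
(* [A] has n rows; replacing it by a square [C] with the same Gram matrix leaves a factor with only
   corank Z rows. *)
have [A AE] := submxP BZ; have [C CE] := psd_gram (psd_mul_tr A).
apply/gram_repP; exists (C *m row_base (kermx Z)) => q.
rewrite -Xa -BE AE !trmx_mul !mulmxA.
by rewrite -[_ *m C^T *m C]mulmxA CE !mulmxA.
Qed.

(** Optimality of M bounds the Gram dimension from above; the SAP makes the chosen completion the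
    only one, and its rank bounds it from below. For corank 0 the vector a is zero, with Gram
    dimension 1. *)
Lemma SAP_gdim (M : 'M[R]_n) : (0 < n)%N -> CG e M -> psd M -> SAP e M ->
  exists a : {ffun VE e -> R}, DG a /\ gdim a = maxn 1 (corank M).
Proof.
move=> n_gt0 CM Mpsd [_ spM]; have [y yM] := CG_sum_Emx CM.
pose B := row_base (kermx M); pose X := B^T *m B.
pose a := [ffun q : VE e => X (VE1 q) (VE2 q)].
have Xpsd : psd X := psd_mul_tr B.
have Xa q : X (VE1 q) (VE2 q) = a q by rewrite ffunE.
have Sa : partial_psd a by exists X.
have MX : M *m X = 0.
  have /sub_kermxP BM : (B <= kermx M)%MS by rewrite eq_row_base.
  have MB : M *m B^T = 0.
    by apply: trmx_inj; rewrite trmx_mul trmxK trmx0 Mpsd.1.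
  by rewrite mulmxA MB mul0mx.
have ya : dual_value a y = 0.
  by rewrite (dual_value_trinner yM Xpsd.1 Xa) /trinner MX linear0.
have yopt : dual_optimal a y M.
  split=> // y' Z' [yZ' Zpsd]; rewrite ya (dual_value_trinner yZ' Xpsd.1 Xa).
  exact: trinner_psd_ge0.
exists a; split; first by split=> //; exists y, M.
have [[g1 /gram_repP[P Pa] _] _] := gdimP n_gt0 Sa.
apply/eqP; rewrite eqn_leq (gdim_dual_optimal n_gt0 Sa yopt) geq_max g1 /=.
(* Any Gram representation of a gives a completion that M also annihilates, so its difference from
   [X] lies in the complement that the SAP makes trivial. *)
have PE : P^T *m P = X.
  have Ppsd := psd_mul_tr P; apply/eqP; rewrite -subr_eq0; apply/eqP.
  apply: tangent_spans_eq0 spM _ _ _ => [||q].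
  - by rewrite /Sym /= linearB /= Ppsd.1 Xpsd.1.
  - rewrite mulmxBr MX subr0 mulmxA trinner_psd_eq0 ?mul0mx //.
    by rewrite -(dual_value_trinner yM Ppsd.1 Pa).
  - by rewrite mxE Pa mxE Xa subrr.
have -> : corank M = \rank X.
  by rewrite /X mxrankMfree ?row_base_free // mxrank_tr eq_row_base.
by rewrite -PE (leq_trans (mxrankM_maxr _ _)) ?rank_leq_row.
Qed.

(** A nondegenerate optimal Z is itself one of the matrices over which nu^= maximises the corank. *)
Lemma DG_gdim (a : {ffun VE e -> R}) : (0 < n)%N -> symmetric e ->
  DG a -> (gdim a <= maxn 1 (nu_eq R e))%N.
Proof.
move=> n_gt0 e_sym [Sa [y [Z [yopt [feas spZ]]]]].
apply: leq_trans (gdim_dual_optimal n_gt0 Sa yopt) _.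
have CZ := dual_feasible_CG e_sym feas.
have := (nu_eqP R e).2 Z CZ feas.2 (conj CZ spZ).
by rewrite geq_max leq_maxl leq_max => ->; rewrite orbT.
Qed.

(** * Positivity of nu^= *)

Lemma tangent_spans_sub (M : 'M[R]_n) :
  [set X + Y | X in tangent M & Y in [set Y | Y \in linE R e]] `<=` @Sym R n.
Proof.
move=> _ [X TX [Y /tr_linE YT <-]].
by rewrite /Sym /= linearD /= (tr_tangent TX) YT.
Qed.

End Graph.

(** For diag(1, ..., 1, 0) the tangent space consists of the symmetric matrices with last diagonal
    entry 0, and the vertex matrix of the last index supplies that entry for every graph. *)
Lemma nu_eq_gt0 (R : realType) (n : nat) (e : rel 'I_n) :
  (0 < n)%N -> (0 < nu_eq R e)%N.
Proof.
case: n e => // m e _.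
pose d : 'rV[R]_m.+1 := \row_j (j < m)%:R.
pose M := diag_mx d.
have MP : M = pid_mx m.
  apply/matrixP => i j; rewrite !mxE -val_eqE /=.
  by case: eqP => //= ->; rewrite mulr1n.
have rM : \rank M = m by rewrite MP rank_pid_mx.
have Mpsd : psd M.
  have := psd_mul_tr M; rewrite /M tr_diag_mx mulmx_diag.
  (* The entries of [d] are 0 or 1, so M = M^T M. *)
  suff -> : \row_j (d 0 j * d 0 j) = d by [].
  by apply/rowP => j; rewrite !mxE; case: (_ < _)%N; rewrite ?mulr1 ?mulr0.
have CM : CG e M.
  split=> [|i j ij _]; first exact: Mpsd.1.
  by rewrite (trinner_Emx _ _ Mpsd.1) mxE (negPf ij).
have cM : corank M = 1%N by rewrite /corank mxrank_ker rM subSnn.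
rewrite -cM; apply: (nu_eqP R e).2 CM Mpsd (conj CM _).
apply/seteqP; split=> [|S ST]; first exact: tangent_spans_sub.
have lastVE :
    (m <= m)%N && ((ord_max == ord_max :> 'I_m.+1) || e ord_max ord_max).
  by rewrite leqnn eqxx.
pose q0 : VE e := exist _ (ord_max, ord_max) lastVE.
pose E : 'M[R]_m.+1 := S ord_max ord_max *: Emx R ord_max ord_max.
have E_lin : E \in linE R e.
  by apply/memvZ/memv_span/mapP; exists q0; rewrite ?mem_enum.
exists (S - E); last by exists E; rewrite ?subrK.
have SET : (S - E)^T = S - E by rewrite linearB /= (tr_linE E_lin) ST.
pose S' : 'M_(\rank M + (m.+1 - \rank M)) :=
  castmx (esym (subnKC (rank_leq_row _)), esym (subnKC (rank_leq_row _)))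
    (S - E).
have ST' : S'^T = S' by rewrite /S' trmx_cast SET.
(* [M] is already diagonal with its nonzero entries first, so Q = 1 serves. *)
exists 1%:M, d, (ulsubmx S'), (ursubmx S'); split.
- split; rewrite ?trmx1 ?mul1mx ?mulmx1 // => i.
  by rewrite mxE rM; case: (_ < _)%N; rewrite ?oner_eq0 ?eqxx.
- by rewrite trmx_ulsub ST'.
rewrite mul1mx trmx1 mulmx1 /tangent_block trmx_ursub ST'.
(* This block is 1 x 1: the last diagonal entry, which subtracting [E] has cancelled. *)
suff -> : 0 = drsubmx S' by rewrite submxK /S' castmx_comp castmx_id.
apply/matrixP=> i j; rewrite !mxE castmxE /= esymK.
have max_eq (k : 'I_(m.+1 - \rank M)) :
    cast_ord (subnKC (rank_leq_row M)) (rshift (\rank M) k) = ord_max.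
  apply: val_inj; case: k => k /=; rewrite rM subSnn ltnS leqn0 => /eqP->.
  exact: addn0.
by rewrite !max_eq !mxE !eqxx -mulr2n mulVf ?mulr1 ?subrr ?pnatr_eq0.
Qed.

Theorem corollary5p10 (R : realType) (n : nat) (e : rel 'I_n)
    (n_gt0 : (0 < n)%N) (e_sym : symmetric e) (e_irr : irreflexive e) :
  (nu_eq R e <= gd_graph R e)%N /\
  (gd_graph R e = nu_eq R e <->
   exists a : {ffun VE e -> R}, DG a /\ gd_graph R e = gdim a).
Proof.
have [_ gd_max] := gd_graphP R e n_gt0.
(* Positivity turns each maximum of 1 and nu^= below into nu^= itself. *)
have nu_gt0 := nu_eq_gt0 R e n_gt0.
have [a [DGa ga]] : exists a : {ffun VE e -> R}, DG a /\ gdim a = nu_eq R e.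
  have [[M [CM Mpsd SM cM]] _] := nu_eqP R e.
  have [a [DGa ga]] := SAP_gdim n_gt0 CM Mpsd SM.
  by exists a; rewrite ga cM (maxn_idPr nu_gt0).
have nu_le : (nu_eq R e <= gd_graph R e)%N by rewrite -ga gd_max //; case: DGa.
split=> //; split=> [->|[b [DGb gb]]]; first by exists a.
apply/eqP; rewrite eqn_leq nu_le andbT gb.
by have := DG_gdim n_gt0 e_sym DGb; rewrite (maxn_idPr nu_gt0).
Qed.
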